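(* Let $G$ be a finite connected simple graph with an external equitable partition $\pi$ into node groups $\mathcal{N}_1,\dots,\mathcal{N}_K$, let $G^{\pi}$ be the corresponding quotient graph, and let $r\in\mathbb{R}$. For any eigenstate $\mathbf{y}^\star\in\mathbb{R}^K$ on $G^\pi$ of the system with parameter $r$, the corresponding vector $\mathbf{x}^\star\in\mathbb{R}^N$ with entries $x_i^\star=y_k^\star$ for $i\in\mathcal{N}_k$ is an eigenstate of the system on $G$ with the same parameter $r$.
   Context: $G=(\mathcal{N},\mathcal{L})$ is an undirected graph with $N$ nodes, without self-loops or multiple links; $i\sim j$ means that $i$ and $j$ are linked. The system on $G$ with parameter $r$ is $\frac{dx_i}{dt}=\sum_{j\sim i}\left[r(x_i-x_j)-(x_i-x_j)^3\right]$ for all nodes $i$. Eigenstates on $G$: a nonzero vector $\mathbf{x}^\star\in\mathbb{R}^N$ is an eigenstate of the system on $G$ if it is both a Laplacian eigenvector and a stationary state, i.e. if for some $\mu\in\mathbb{R}$ and for all nodes $i$, $\mu x_i^\star=\sum_{j\sim i}(x_i^\star-x_j^\star)$ and $\sum_{j\sim i}r(x_i^\star-x_j^\star)=\sum_{j\sim i}(x_i^\star-x_j^\star)^3$. External equitable partition: a partition $\pi$ of $\mathcal{N}$ into $K$ disjoint nonempty groups $\mathcal{N}_1,\dots,\mathcal{N}_K$ is an external equitable partition if for all $k\neq m$, every node in $\mathcal{N}_k$ has the same number $d_{km}$ of neighbours in $\mathcal{N}_m$. The quotient graph $G^\pi$ has node set $\{1,\dots,K\}$; for each pair $k\neq m$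 of groups between which there are links in $G$, written $m\sim k$, it has a directed link from $k$ to $m$ with weight $d_{km}$ and one from $m$ to $k$ with weight $d_{mk}$. Eigenstates on $G^\pi$: a nonzero vector $\mathbf{y}^\star\in\mathbb{R}^K$ is an eigenstate of the system on $G^\pi$ if for some $\mu\in\mathbb{R}$ and for all $k$, $\sum_{m\sim k}d_{km}(y_k^\star-y_m^\star)=\mu y_k^\star$ and $\sum_{m\sim k}d_{km}\,r(y_k^\star-y_m^\star)=\sum_{m\sim k}d_{km}(y_k^\star-y_m^\star)^3$. *)

(* Defs.v *)
From mathcomp Require Import all_boot all_order all_algebra.
From mathcomp Require Export reals.

Set Implicit Arguments.
Unset Strict Implicit.
Unset Printing Implicit Defensive.

Import GRing.Theory Num.Theory.
Local Open Scope ring_scope.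

Record sgraph (N : nat) := SGraph {
  adj :> rel 'I_N;
  adj_sym : symmetric adj;
  adj_irr : irreflexive adj }.

Definition gconnected (N : nat) (G : sgraph N) : Prop :=
  forall i j : 'I_N, connect G i j.

(* [eep_deg pi k m] is the number d_km; since the groups are nonempty it is
   determined by them for k != m. Its diagonal values are unconstrained, and
   never used. *)
Record ext_equitable_partition (N : nat) (G : sgraph N) (K : nat) := EEP {
  group : 'I_K -> {set 'I_N};
  group_neq0 : forall k, group k != set0;
  group_disjoint : forall k m, k != m -> [disjoint group k & group m];
  group_cover : \bigcup_(k < K) group k = [set: 'I_N];
  eep_deg : 'I_K -> 'I_K -> nat;
  eep_degP : forall k m, k != m ->
    forall i, i \in group k -> #|[set j in group m | G i j]| = eep_deg k m }.

Record wdigraph (K : nat) := WDigraph {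
  link : rel 'I_K;
  weight : 'I_K -> 'I_K -> nat }.

Definition quotient_graph (N : nat) (G : sgraph N) (K : nat)
    (pi : ext_equitable_partition G K) : wdigraph K :=
  {| link := fun k m =>
       (k != m) && [exists i in group pi k, exists j in group pi m, G i j];
     weight := eep_deg pi |}.

Definition eigenstate (R : realType) (N : nat) (G : sgraph N) (r : R)
    (x : 'cV[R]_N) : Prop :=
  [/\ x != 0,
      exists mu : R, forall i,
        mu * x i 0 = \sum_(j | G i j) (x i 0 - x j 0)
    & forall i,
        \sum_(j | G i j) r * (x i 0 - x j 0)
        = \sum_(j | G i j) (x i 0 - x j 0) ^+ 3].

Definition quotient_eigenstate (R : realType) (K : nat) (Q : wdigraph K)
    (r : R) (y : 'cV[R]_K) : Prop :=
  [/\ y != 0,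
      exists mu : R, forall k,
        \sum_(m | link Q k m) (weight Q k m)%:R * (y k 0 - y m 0) = mu * y k 0
    & forall k,
        \sum_(m | link Q k m) (weight Q k m)%:R * (r * (y k 0 - y m 0))
        = \sum_(m | link Q k m) (weight Q k m)%:R * (y k 0 - y m 0) ^+ 3].

(* Main.v *)
Require Import Defs.
From mathcomp Require Import all_boot all_order all_algebra.

Import GRing.Theory.

Local Open Scope ring_scope.

(** For any function on the groups that vanishes on the group of a node [i],
    summing over the neighbours of [i] in the graph is the same as summing over
    the out-neighbours of that group in the quotient, with weights [d_km]
    ([sum_neighbours_quotient]). Every coupling in the problem is a function of
    a difference that vanishes at [0], hence vanishes inside a group when [x] is
    constant on groups. So the three sums at [i] (linear, linear times [r],
    cubic) are exactly the corresponding quotient sums at its group, and both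
    the Laplacian equation, with the same [mu], and the stationarity equation
    carry over verbatim. Finally [x] is nonzero because every group is nonempty,
    so every entry of [y] occurs as an entry of [x]. *)

Lemma cell_exists {N : nat} {G : sgraph N} {K : nat}
    (pi : ext_equitable_partition G K) (i : 'I_N) :
  exists k, i \in group pi k.
Proof.
have: i \in \bigcup_(k < K) group pi k by rewrite group_cover inE.
by case/bigcupP=> k _; exists k.
Qed.

Definition cell {N : nat} {G : sgraph N} {K : nat}
    (pi : ext_equitable_partition G K) (i : 'I_N) : 'I_K :=
  xchoose (cell_exists pi i).

Lemma mem_cell {N : nat} {G : sgraph N} {K : nat}
    (pi : ext_equitable_partition G K) (i : 'I_N) :
  i \in group pi (cell pi i).
Proof. exact: (xchooseP (cell_exists pi i)). Qed.

Lemma cell_eq {N : nat} {G : sgraph N} {K : nat}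
    (pi : ext_equitable_partition G K) (i : 'I_N) (k : 'I_K) :
  (cell pi i == k) = (i \in group pi k).
Proof.
apply/eqP/idP => [<-|ik]; first exact: mem_cell.
have [//|ne_k] := eqVneq (cell pi i) k.
by rewrite (disjointFr (group_disjoint pi ne_k) (mem_cell pi i)) in ik.
Qed.

(** Sort the neighbours of [i] by group. A group [m] other than that of [i]
    contains exactly [d_km] of them by equitability; it contains none when
    [m] is not linked to [k], which matches its absence from the quotient sum.
    The neighbours inside the own group, in whatever number, contribute [0]
    because [g k = 0]. *)
Lemma sum_neighbours_quotient {R : pzSemiRingType} {N : nat}
    {G : sgraph N} {K : nat} (pi : ext_equitable_partition G K) (g : 'I_K -> R) (i : 'I_N) :
  let Q := quotient_graph pi in let k := cell pi i in
  g k = 0 ->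
  \sum_(j | G i j) g (cell pi j)
  = \sum_(m | link Q k m) (weight Q k m)%:R * g m.
Proof.
move=> Q k gk0.
rewrite (partition_big (cell pi) xpredT) //= [RHS]big_mkcond /=.
apply: eq_bigr => m _.
have [<-|ne_km] /= := eqVneq k m.
  by rewrite big1 // => j /andP[_ /eqP ->].
have ik : i \in group pi k := mem_cell pi i.
case: ifPn => [_|/exists_inPn no_link].
  transitivity (\sum_(j in [set j in group pi m | G i j]) g m).
    apply: eq_big => [j|j /andP[_ /eqP -> //]].
    by rewrite inE cell_eq andbC.
  by rewrite sumr_const (eep_degP ne_km ik) mulr_natl.
rewrite big_pred0 // => j; rewrite cell_eq.
apply: contraNF (no_link i ik) => /andP[Gij jm].
by apply/exists_inP; exists j.
Qed.

Theorem proposition3 (R : realType) (N : nat) (G : sgraph N)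
    (Gconn : gconnected G) (K : nat) (pi : ext_equitable_partition G K)
    (r : R) (y : 'cV[R]_K) (Hy : quotient_eigenstate (quotient_graph pi) r y)
    (x : 'cV[R]_N)
    (Hx : forall (k : 'I_K) (i : 'I_N), i \in group pi k -> x i 0 = y k 0) :
  eigenstate G r x.
Proof.
case: Hy => y_neq0 [mu eigen_y] stat_y.
have xE i : x i 0 = y (cell pi i) 0 by exact: Hx (mem_cell pi i).
have coupling (f : R -> R) i : f 0 = 0 ->
    let Q := quotient_graph pi in let k := cell pi i in
    \sum_(j | G i j) f (x i 0 - x j 0)
    = \sum_(m | link Q k m) (weight Q k m)%:R * f (y k 0 - y m 0).
  move=> f0 Q k.
  rewrite -(sum_neighbours_quotient pi (fun m => f (y k 0 - y m 0))) ?subrr //.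
  by apply: eq_bigr => j _; rewrite !xE.
split.
- apply: contraNneq y_neq0 => x0; apply/eqP/matrixP => k c.
  rewrite (ord1 c) mxE.
  by have /set0Pn[i ik] := group_neq0 pi k; rewrite -(Hx k i ik) x0 mxE.
- by exists mu => i; rewrite (coupling id) // eigen_y xE.
- move=> i; rewrite (coupling (fun t => r * t)) ?mulr0 //.
  by rewrite (coupling (fun t => t ^+ 3)) ?expr0n // stat_y.
Qed.
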